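(* For every ternary cubic $f\in\mathcal{Q}_3^3$, $$(\Delta\Phi)(f)=-\frac{1}{36}\,\mathrm{I}_6(f)\,\mathrm{P}(f)-\frac{1}{27}\,\mathrm{I}_4(f)\,\mathrm{Q}(f)$$ as cubic forms on $\mathbb{C}^{3*}$.
   Context: $\mathcal{Q}_3^3$ is the complex vector space of ternary cubic forms in $z_1,z_2,z_3$, with $\mathrm{GL}_3(\mathbb{C})$ acting by $(C\cdot f)(z)=f(C^{-1}z)$; $\mathrm{GL}_3(\mathbb{C})$ acts on row vectors $z^*=(z_1^*,z_2^*,z_3^* )\in\mathbb{C}^{3*}$ by $C\cdot z^*=z^*C^{-1}$. A contravariant of ternary cubics is a polynomial $\Lambda(f,z^* )$ on $\mathcal{Q}_3^3\times\mathbb{C}^{3*}$ with $\Lambda(f,z^* )=(\det C)^k\Lambda(C\cdot f,C\cdot z^* )$ for all $C\in\mathrm{GL}_3(\mathbb{C})$ and a fixed integer $k$; if homogeneous, its degrees in $f$ and $z^*$ are called degree and class. We write $\Lambda(f)$ for the form $z^*\mapsto\Lambda(f,z^* )$. Every nondegenerate ternary cubic is linearly equivalent to one of the form $f=az_1^3+bz_2^3+cz_3^3+6dz_1z_2z_3$, and the following objects are determined by their values on these. $\mathrm{I}_4,\mathrm{I}_6$ are the Aronhold invariants, the $\mathrm{SL}_3$-invariant homogeneous polynomials of degrees 4, 6 on $\mathcal{Q}_3^3$ with $\mathrm{I}_4(f)=abcd-d^4$ and $\mathrm{I}_6(f)=a^2b^2c^2-20abcd^3-8d^6$ for such $f$.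 The Pippian $\mathrm{P}$ (degree 3, class 3) and the Quippian $\mathrm{Q}$ (degree 5, class 3) are the contravariants with, for such $f$, $$\mathrm{P}(f)(z^* )=-d(bcz_1^{*3}+acz_2^{*3}+abz_3^{*3})-(abc-4d^3)z_1^*z_2^*z_3^*,$$ $$\mathrm{Q}(f)(z^* )=(abc-10d^3)(bcz_1^{*3}+acz_2^{*3}+abz_3^{*3})-6d^2(5abc+4d^3)z_1^*z_2^*z_3^*.$$ The discriminant is normalized as $\Delta=\mathrm{I}_6^2+64\,\mathrm{I}_4^3$, and $X_3^3=\{f\in\mathcal{Q}_3^3:\Delta(f)\ne0\}$ (the nondegenerate cubics). For $f\in X_3^3$ let $M_f=\mathbb{C}[z_1,z_2,z_3]/(\partial f/\partial z_1,\partial f/\partial z_2,\partial f/\partial z_3)$, a finite-dimensional local Gorenstein algebra whose socle is one-dimensional, equals the degree 3 part of $M_f$, and is spanned by the class of the Hessian $H(f)=\det(\partial^2f/\partial z_i\partial z_j)$. Let $\omega:\mathrm{Soc}(M_f)\to\mathbb{C}$ be the linear isomorphism with $\omega(H(f))=1$ and $\mathbf{z}_j\in M_f$ the class of $z_j$. The associated form of $f$ is the cubic form on $\mathbb{C}^{3*}$ given by $\Phi(f)(z^* )=\omega\big((z_1^*\mathbf{z}_1+z_2^*\mathbf{z}_2+z_3^*\mathbf{z}_3)^3\big)$. The map $f\mapsto\Delta(f)\Phi(f)$ on $X_3^3$ extends (uniquely) to a polynomial map on all of $\mathcal{Q}_3^3$, denoted $\Delta\Phi$. *)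

(* Defs.v *)
From HB Require Import structures.
From mathcomp Require Import all_boot all_order all_algebra.
From mathcomp Require Import ring_quotient.
From mathcomp Require Import boolp classical_sets functions reals.
From mathcomp.real_closed Require Import complex.
From mathcomp Require Import mpoly.

Set Implicit Arguments.
Unset Strict Implicit.
Unset Printing Implicit Defensive.

Import GRing.Theory.
Local Open Scope ring_scope.
Local Open Scope quotient_scope.
Local Open Scope classical_set_scope.

Section PolynomialFunctions.
Variable K : fieldType.

(* Coordinates are taken in the basis [vbasis fullv]; being polynomial does not
   depend on the basis. *)
Definition polynomial_fun (V : vectType K) (F : V -> K) : Prop :=
  exists p : {mpoly K[\dim (fullv : {vspace V})]},
    forall v : V, F v = p.@[fun i => coord (vbasis fullv) i v].

Definition polynomial_map (V W : vectType K) (F : V -> W) : Prop :=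
  forall i : 'I_(\dim (fullv : {vspace W})),
    polynomial_fun (fun v => coord (vbasis fullv) i (F v)).

Definition homogeneous_fun (V : lmodType K) (d : nat) (F : V -> K) : Prop :=
  forall (t : K) (v : V), F (t *: v) = t ^+ d * F v.

End PolynomialFunctions.

(* [dhomog n K d] is the vector space of forms of degree d in n variables. *)
Notation cubic K := (dhomog 3 K 3).

Section GroupAction.
Variable K : fieldType.

(* f(C^-1 z), where z is the column of the three variables *)
Definition act_poly (C : 'M[K]_3) (f : {mpoly K[3]}) : {mpoly K[3]} :=
  f \mPo [tuple \sum_(k < 3) (invmx C) j k *: 'X_k | j < 3].

Fact act_dhomog (C : 'M[K]_3) (f : cubic K) : act_poly C f \is 3%N.-homog.
Proof.
rewrite /act_poly; set t := mktuple _.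
have t1 i : tnth t i \is 1.-homog.
  rewrite tnth_mktuple; apply: rpred_sum => k _; apply: rpredZ.
  by rewrite dhomogX /= mdeg1.
rewrite comp_mpolyE big_seq; apply: rpred_sum => m mf; apply: rpredZ.
have dm : mdeg m = 3%N by move/dhomogP: (dhomog_is_dhomog f); apply.
suff: \prod_(i < 3) tnth t i ^+ m i \is (mdeg m).-homog by rewrite dm.
rewrite mdegE.
apply: (big_ind2 (fun (p : {mpoly K[3]}) (d : nat) => p \is d.-homog)).
- exact: dhomog1.
- by move=> p d q e pd qe; apply: dhomogM.
- by move=> i _; rewrite -[X in X.-homog]mul1n; apply: dhomogMn.
Qed.

Definition act (C : 'M[K]_3) (f : cubic K) : cubic K := DHomog (act_dhomog C f).

Definition dual_act (C : 'M[K]_3) (z : 'rV[K]_3) : 'rV[K]_3 := z *m invmx C.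

Definition SL3_invariant (I : cubic K -> K) : Prop :=
  forall (C : 'M[K]_3) (f : cubic K), \det C = 1 -> I (act C f) = I f.

Definition contravariant (L : cubic K -> 'rV[K]_3 -> K) : Prop :=
  polynomial_fun (fun v : (cubic K * 'rV[K]_3)%type => L v.1 v.2) /\
  exists k : int, forall (C : 'M[K]_3) (f : cubic K) (z : 'rV[K]_3),
    C \in unitmx -> L f z = (\det C) ^ k * L (act C f) (dual_act C z).

Definition contravariant_of (degree class : nat)
    (L : cubic K -> 'rV[K]_3 -> K) : Prop :=
  [/\ contravariant L,
      forall z, homogeneous_fun degree (fun f => L f z)
    & forall f, homogeneous_fun class (L f)].

End GroupAction.

Section ClassicalConcomitants.
Variable K : fieldType.

Definition hesse_form (f : cubic K) (a b c d : K) : Prop :=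
  f = a *: 'X_0 ^+ 3 + b *: 'X_1 ^+ 3 + c *: 'X_2 ^+ 3
      + (6 * d) *: ('X_0 * 'X_1 * 'X_2) :> {mpoly K[3]}.

(* The next four predicates determine their argument uniquely when K is
   algebraically closed of characteristic 0. *)
Definition aronhold_I4 (I4 : cubic K -> K) : Prop :=
  [/\ polynomial_fun I4, homogeneous_fun 4 I4, SL3_invariant I4
    & forall f a b c d, hesse_form f a b c d ->
        I4 f = a * b * c * d - d ^+ 4].

Definition aronhold_I6 (I6 : cubic K -> K) : Prop :=
  [/\ polynomial_fun I6, homogeneous_fun 6 I6, SL3_invariant I6
    & forall f a b c d, hesse_form f a b c d ->
        I6 f = a ^+ 2 * b ^+ 2 * c ^+ 2 - 20 * (a * b * c * d ^+ 3)
               - 8 * d ^+ 6].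

Definition pippian (P : cubic K -> 'rV[K]_3 -> K) : Prop :=
  contravariant_of 3 3 P /\
  forall f a b c d, hesse_form f a b c d -> forall z : 'rV[K]_3,
    P f z =
      - d * (b * c * z 0 0 ^+ 3 + a * c * z 0 1 ^+ 3 + a * b * z 0 2 ^+ 3)
      - (a * b * c - 4 * d ^+ 3) * (z 0 0 * z 0 1 * z 0 2).

Definition quippian (Q : cubic K -> 'rV[K]_3 -> K) : Prop :=
  contravariant_of 5 3 Q /\
  forall f a b c d, hesse_form f a b c d -> forall z : 'rV[K]_3,
    Q f z =
      (a * b * c - 10 * d ^+ 3) *
        (b * c * z 0 0 ^+ 3 + a * c * z 0 1 ^+ 3 + a * b * z 0 2 ^+ 3)
      - 6 * d ^+ 2 * (5 * (a * b * c) + 4 * d ^+ 3) *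
        (z 0 0 * z 0 1 * z 0 2).

Definition discriminant (I4 I6 : cubic K -> K) (f : cubic K) : K :=
  I6 f ^+ 2 + 64 * I4 f ^+ 3.

End ClassicalConcomitants.

Section MilnorAlgebra.
Variables (K : fieldType) (f : cubic K).

Definition jacobian_ideal : {mpoly K[3]} -> bool := fun p =>
  `[< exists a : 'I_3 -> {mpoly K[3]}, p = \sum_i a i * f^`M(i) >].

Fact jacobian_idealr_closed : idealr_closed jacobian_ideal.
Proof.
split.
- by apply/asboolP; exists (fun=> 0); rewrite big1 // => i _; rewrite mul0r.
- apply/negP => /asboolP[a /(congr1 (fun p : {mpoly K[3]} => p@_0%MM))].
  rewrite mcoeff1 eqxx raddf_sum /= big1 => [/eqP|i _]; first by rewrite oner_eq0.
  have f'0 : (f^`M(i))@_0 = 0.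
    rewrite mcoeff_deriv (dhomog_nemf_coeff (dhomog_is_dhomog f)) ?mul0rn //.
    by rewrite /= mdegD mdeg0 mdeg1.
  by rewrite [LHS](rmorphM (mcoeff 0%MM)) [X in _ * X]f'0 mulr0.
- move=> u p q /asboolP[a ->] /asboolP[b ->]; apply/asboolP.
  exists (fun i => u * a i + b i); rewrite mulr_sumr -big_split /=.
  by apply: eq_bigr => i _; rewrite mulrDl mulrA.
Qed.

HB.instance Definition _ :=
  isIdealr.Build {mpoly K[3]} jacobian_ideal jacobian_idealr_closed.

Definition jacobian : idealr {mpoly K[3]} := jacobian_ideal.

Local Notation milnor := {ideal_quot jacobian}.

Definition mcls (p : {mpoly K[3]}) : milnor :=
  \pi_milnor p.

(* The maximal ideal when [milnor] is local, i.e. f is nondegenerate. *)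
Definition nonunits : set milnor := [set y | ~ exists y', y' * y = 1].

Definition socle : set milnor :=
  [set x | forall y, nonunits y -> y * x = 0].

Definition hessian : {mpoly K[3]} := \det (\matrix_(i, j) f^`M(i)^`M(j)).

(* The values of w outside the socle are irrelevant: cubes of linear forms lie
   in the socle when f is nondegenerate. *)
Definition socle_iso (w : milnor -> K) : Prop :=
  [/\ forall c x y, socle x -> socle y ->
        w (mcls c%:MP * x + y) = c * w x + w y,
      set_bij socle setT w,
      socle (mcls hessian)
    & w (mcls hessian) = 1].

Definition omega : milnor -> K := xget (fun=> 0) [set w | socle_iso w].

Definition associated_form (z : 'rV[K]_3) : K :=
  omega ((\sum_j mcls (z 0 j)%:MP * mcls 'X_j) ^+ 3).

End MilnorAlgebra.

(* A cubic form on the dual space is represented by a polynomial in the dual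
   variables. *)
Definition is_DeltaPhi (K : fieldType) (I4 I6 : cubic K -> K)
    (DPhi : cubic K -> cubic K) : Prop :=
  polynomial_map DPhi /\
  forall f, discriminant I4 I6 f != 0 -> forall z : 'rV[K]_3,
    (DPhi f : {mpoly K[3]}).@[fun j => z 0 j] =
      discriminant I4 I6 f * associated_form f z.

(* Main.v *)
(** Both sides are polynomial in f, and the cubics C . h_d with C in GL_3 and
    h_d = z_1^3 + z_2^3 + z_3^3 + 6 d z_1 z_2 z_3 are dense: the derivative of
    (C, d) |-> C . h_d at (1, 0) hits all the monomials.  Density is used in the
    elementary form "a polynomial vanishing along curves v0 + t s + O(t^2), for
    every direction s, is zero".  Along the orbit of h_d both sides get
    multiplied by (det C)^-10, for the invariants and contravariants by
    extracting a cube root of det C to reduce to SL_3, for the associated form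
    by transporting a linear functional that vanishes on the Jacobian ideal and
    is normalised on the Hessian.  At h_d itself such a functional is
    p |-> coefficient of z_1 z_2 z_3 minus 2 d times the sum of the coefficients
    of the z_i^3, up to scaling, and the identity is a computation with
    Delta (h_d) = (1 + 8 d^3)^3. *)

From HB Require Import structures.
Require Import Defs.
From mathcomp Require Import all_boot all_order all_algebra.
From mathcomp Require Import ring_quotient.
From mathcomp Require Import boolp classical_sets functions reals.
From mathcomp.real_closed Require Import complex.
From mathcomp Require Import mpoly.
From mathcomp Require Import ring.

Set Implicit Arguments.
Unset Strict Implicit.
Unset Printing Implicit Defensive.

Import GRing.Theory Num.Theory.
Local Open Scope ring_scope.
Local Open Scope quotient_scope.

(** * Closure properties of polynomial functions *)

Section PolynomialFun.
Variable K : fieldType.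
Implicit Types V W : vectType K.

Lemma polynomial_fun_cst V (c : K) : polynomial_fun (fun _ : V => c).
Proof. by exists c%:MP => v; rewrite mevalC. Qed.

Lemma polynomial_funD V (F G : V -> K) :
  polynomial_fun F -> polynomial_fun G -> polynomial_fun (fun v => F v + G v).
Proof. by move=> [p Fp] [q Gq]; exists (p + q) => v; rewrite mevalD Fp Gq. Qed.

Lemma polynomial_funM V (F G : V -> K) :
  polynomial_fun F -> polynomial_fun G -> polynomial_fun (fun v => F v * G v).
Proof. by move=> [p Fp] [q Gq]; exists (p * q) => v; rewrite mevalM Fp Gq. Qed.

Lemma polynomial_fun_sum V (I : Type) (r : seq I) (F : I -> V -> K) :
  (forall i, polynomial_fun (F i)) -> polynomial_fun (fun v => \sum_(i <- r) F i v).
Proof.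
move=> Fp; elim: r => [|i r [p IH]].
  by exists 0 => v; rewrite big_nil meval0.
have [q Fq] := Fp i; exists (q + p) => v.
by rewrite big_cons Fq IH mevalD.
Qed.

Lemma polynomial_fun_coord V i :
  polynomial_fun (fun v : V => coord (vbasis fullv) i v).
Proof. by exists 'X_i => v; rewrite mevalXU. Qed.

Lemma polynomial_fun_scalar V (F : V -> K) : scalar F -> polynomial_fun F.
Proof.
move=> Fs; pose L : {linear V -> K^o} := HB.pack F (GRing.isLinear.Build K V K^o _ F Fs).
have -> : F = (fun v => \sum_i coord (vbasis fullv) i v * F (vbasis fullv)`_i).
  apply/funext => v; rewrite {1}(coord_vbasis (memvf v)).
  by rewrite -[F]/(L : V -> K^o) linear_sum; apply: eq_bigr => i _; rewrite linearZ.
apply: polynomial_fun_sum => i; apply: polynomial_funM.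
  exact: polynomial_fun_coord.
exact: polynomial_fun_cst.
Qed.

Lemma polynomial_fun_comp V n (p : {mpoly K[n]}) (G : 'I_n -> V -> K) :
  (forall i, polynomial_fun (G i)) ->
  polynomial_fun (fun v => p.@[fun i => G i v]).
Proof.
move=> /choice[q Gq]; exists (p \mPo [tuple q i | i < n]) => v.
by rewrite comp_mpoly_meval; apply: meval_eq => i; rewrite tnth_mktuple Gq.
Qed.

(** Serves to move the base point of the curves to the origin, and to freeze the dual variable of a
    contravariant, which is polynomial in both arguments jointly. *)
Lemma polynomial_fun_affine V W (F : W -> K) (A : V -> W) (w : W) :
  linear A -> polynomial_fun F -> polynomial_fun (fun v => F (A v + w)).
Proof.
move=> Al [p Fp]; under eq_fun => v do rewrite Fp.
apply: polynomial_fun_comp => i; under eq_fun => v do rewrite linearD.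
apply: polynomial_funD; last exact: polynomial_fun_cst.
by apply: polynomial_fun_scalar => a u v; rewrite Al linearP.
Qed.

Lemma polynomial_map_scalar V W (F : V -> W) (A : W -> K) :
  scalar A -> polynomial_map F -> polynomial_fun (fun v => A (F v)).
Proof.
move=> As Fp; have [p Ap] := polynomial_fun_scalar As.
under eq_fun => v do rewrite Ap.
exact: polynomial_fun_comp.
Qed.

End PolynomialFun.

(** * Density: polynomials vanishing along curves in every direction *)

Section Density.
Variable K : numFieldType.

Lemma poly_eq0_horner (p : {poly K}) : (forall t, p.[t] = 0) -> p = 0.
Proof.
move=> p0; apply/eqP; apply: contraT => /max_poly_roots.
(* The roots 0, 1, 2, ... are distinct in characteristic 0, and [size p] of them are too many for a
   nonzero p. *)
move/(_ [seq i%:R | i <- iota 0 (size p)]).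
rewrite size_map size_iota ltnn; apply.
  by apply/allP => _ /mapP[i _ ->]; rewrite /root p0.
rewrite map_inj_uniq ?iota_uniq // => i j /eqP.
by rewrite eqr_nat => /eqP.
Qed.

Lemma meval_curve n (p : {mpoly K[n]}) (c : 'I_n -> {poly K}) :
  exists r : {poly K}, forall t, r.[t] = p.@[fun i => (c i).[t]].
Proof.
exists (mmap polyC c p) => t.
rewrite mevalE /mmap horner_sum; apply: eq_bigr => m _.
rewrite hornerM hornerC /mmap1 horner_prod; congr (_ * _).
by apply: eq_bigr => i _; rewrite horner_exp.
Qed.

Lemma meval_homogZ n d (p : {mpoly K[n]}) (t : K) (x : 'I_n -> K) :
  p \is d.-homog -> p.@[fun i => t * x i] = t ^+ d * p.@[x].
Proof.
move=> /dhomogP dp; rewrite !mevalE mulr_sumr big_seq [RHS]big_seq.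
apply: eq_bigr => m /dp /= <-; rewrite mulrCA; congr (_ * _).
rewrite mdegE -prodrXr -big_split /=.
by apply: eq_bigr => i _; rewrite exprMn.
Qed.

(* The parametrisation s |-> t s + t^2 c_s(t) is tangent to the identity, so
   the lowest homogeneous part of q along it is that of q itself. *)
Lemma meval_eq0_curves n (q : {mpoly K[n]}) :
  (forall s : 'I_n -> K, exists (c : 'I_n -> {poly K}) (D : {poly K}),
     D != 0 /\ forall t, D.[t] != 0 ->
       q.@[fun i => t * (s i + t * (c i).[t])] = 0) ->
  forall x, q.@[x] = 0.
Proof.
move=> q0 x; pose h d := pihomog mdeg d q.
have qE y : q.@[y] = \sum_(d < msize q) (h d).@[y].
  by rewrite {1}(pihomog_partitionE (leqnn (msize q))) raddf_sum.
suff h0 d y : (h d).@[y] = 0 by rewrite qE big1.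
(* Strong induction on the degree: when degree d is reached, all lower components vanish
   identically. *)
elim/ltn_ind: d y => d IH s.
have [c [D [D0 cD]]] := q0 s.
have /choice[r rE] e := meval_curve (h e) (fun i => (s i)%:P + 'X * c i).
have [lt_d|le_d] := ltnP d (msize q); last first.
  rewrite /h pihomogE big_seq_cond big1 ?meval0 // => m /andP[mq /eqP md].
  by have := msize_mdeg_lt mq; rewrite md ltnNge le_d.
(* Homogeneity pulls t^e out of the component of degree e along the curve; [S] is what remains of q
   there after division by t^d. *)
pose S := \sum_(d <= e < msize q) 'X ^+ (e - d) * r e.
have rh e t : (r e).[t] = (h e).@[fun i => s i + t * (c i).[t]].
  by rewrite rE; apply: meval_eq => i; rewrite !hornerE.
(* The factor [D] makes the product vanish also at the excluded values of t. *)
have SD0 : 'X ^+ d * S * D = 0.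
  apply: poly_eq0_horner => t; rewrite hornerM.
  have [->|Dt] := eqVneq D.[t] 0; first by rewrite mulr0.
  rewrite -(mul0r D.[t]); congr (_ * _); rewrite -[RHS](cD t Dt) qE.
  rewrite -(big_mkord xpredT (fun e => (h e).@[_])).
  rewrite (big_cat_nat (n := d)) //=; last exact: ltnW.
  rewrite big_nat big1 => [|e /andP[_ ed]]; last exact: IH.
  rewrite add0r /S mulr_sumr horner_sum [LHS]big_nat [RHS]big_nat.
  apply: eq_bigr => e /andP[de _].
  rewrite mulrA -exprD subnKC // !hornerE rh.
  by rewrite -(meval_homogZ _ _ (pihomogP _ _ _)).
move/eqP: SD0; rewrite !mulf_eq0 (negPf D0) orbF expf_eq0 polyX_eq0 andbF /=.
(* At t = 0 only the term e = d of [S] survives, and it is the value of that component at s. *)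
move=> /eqP/(congr1 (fun p => p.[0])); rewrite horner0 /S big_ltn // subnn expr0 mul1r.
rewrite hornerD rh => /esym; rewrite horner_sum big_nat big1 ?addr0.
  by move=> ->; apply: meval_eq => i; rewrite mul0r addr0.
by move=> e /andP[de _]; rewrite hornerM hornerXn expr0n subn_eq0 leqNgt de mul0r.
Qed.

Lemma polynomial_fun_eq0_curves (V : vectType K) (F : V -> K) (v0 : V) :
  polynomial_fun F ->
  (forall s : V, exists (m : nat) (w : 'I_m -> V) (D : {poly K}),
     D != 0 /\ forall t, D.[t] != 0 ->
       F (v0 + t *: s + \sum_(k < m) t ^+ k.+2 *: w k) = 0) ->
  forall v, F v = 0.
Proof.
move=> Fp Fc v.
have [q Fq] : polynomial_fun (fun v => F (v + v0)).
  by apply: (@polynomial_fun_affine _ _ _ _ idfun).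
rewrite -(subrK v0 v) Fq; apply: meval_eq0_curves => s.
have [m [w [D [D0 cD]]]] := Fc (\sum_i s i *: (vbasis fullv)`_i).
(* These are the i-th coordinates of the terms of order at least 2 of the curve, divided by t^2. *)
pose c i := \sum_(k < m) coord (vbasis fullv) i (w k) *: 'X^k : {poly K}.
exists c, D; split=> // t /cD.
rewrite -addrA addrC Fq => <-; apply: meval_eq => i.
rewrite linearD linearZ /=.
have -> : coord (vbasis fullv) i (\sum_j s j *: (vbasis fullv)`_j) = s i.
  by rewrite coord_sum_free // (basis_free (vbasisP _)).
rewrite mulrDr linear_sum /=; congr (_ + _); rewrite mulrA /c horner_sum mulr_sumr.
by apply: eq_bigr => k _; rewrite linearZ !hornerE /= !exprS; ring.
Qed.

End Density.

(** * The Milnor algebra and the associated form, computed from a functional *)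

Section AssociatedForm.
Variable K : fieldType.
Implicit Types (f : cubic K) (p q : {mpoly K[3]}) (l : {mpoly K[3]} -> K).

Definition vanish0 p : Prop := p.@[fun=> 0] = 0.

Lemma jacobian_idealP f p :
  reflect (exists a : 'I_3 -> {mpoly K[3]}, p = \sum_i a i * f^`M(i))
          (jacobian_ideal f p).
Proof. exact: asboolP. Qed.

Lemma jacobian_ideal0 f : jacobian_ideal f 0.
Proof. exact: (rpred0 (jacobian f)). Qed.

Lemma jacobian_idealD f p q :
  jacobian_ideal f p -> jacobian_ideal f q -> jacobian_ideal f (p + q).
Proof. exact: (@rpredD _ (jacobian f)). Qed.

Lemma jacobian_idealN f p : jacobian_ideal f p -> jacobian_ideal f (- p).
Proof. by rewrite -mulN1r; apply: (@idealMr _ (jacobian f)). Qed.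

Lemma jacobian_idealB f p q :
  jacobian_ideal f p -> jacobian_ideal f q -> jacobian_ideal f (p - q).
Proof. exact: (@rpredB _ (jacobian f)). Qed.

Lemma jacobian_idealMl f p q : jacobian_ideal f q -> jacobian_ideal f (p * q).
Proof. exact: (@idealMr _ (jacobian f)). Qed.

Lemma mcls_eq f p q : mcls f p = mcls f q <-> jacobian_ideal f (p - q).
Proof.
rewrite /mcls; split=> [/eqP|h]; last apply/eqP.
  by rewrite -(Quotient.idealrBE (jacobian f)).
by rewrite -(Quotient.idealrBE (jacobian f)).
Qed.

Lemma mcls0 f : mcls f 0 = 0.
Proof. exact: rmorph0. Qed.

Lemma mcls1 f : mcls f 1 = 1.
Proof. exact: rmorph1. Qed.

Lemma mclsD f p q : mcls f (p + q) = mcls f p + mcls f q.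
Proof. exact: rmorphD. Qed.

Lemma mclsM f p q : mcls f (p * q) = mcls f p * mcls f q.
Proof. exact: rmorphM. Qed.

Lemma mcls_surj f (x : {ideal_quot jacobian f}) : exists p, x = mcls f p.
Proof. by exists (repr x); rewrite /mcls reprK. Qed.

(* Such an l induces omega on the socle, so that omega never has to be
   unfolded again. *)
Definition socle_functional f l : Prop :=
  [/\ scalar l,
      forall p, jacobian_ideal f p -> l p = 0,
      l (hessian f) = 1,
      forall p q, vanish0 p -> vanish0 q -> jacobian_ideal f (p ^+ 3 * q)
    & (forall q, vanish0 q -> jacobian_ideal f (q * hessian f)) /\
      (forall p, (forall q, vanish0 q -> jacobian_ideal f (q * p)) ->
        jacobian_ideal f (p - l p *: hessian f))].

Section Functional.
Variables (f : cubic K) (l : {mpoly K[3]} -> K).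
Hypothesis fl : socle_functional f l.

Lemma socle_functional_notin1 : ~ jacobian_ideal f 1.
Proof.
have [_ lJ lH _ _] := fl => J1.
have /lJ/eqP : jacobian_ideal f (hessian f).
  by rewrite -[hessian f]mulr1; apply: jacobian_idealMl.
by rewrite lH oner_eq0.
Qed.

(** The fourth power of a polynomial without constant term lies in the Jacobian ideal, so its class
    is nilpotent and the quotient is local with residue field K. *)
Lemma nonunits_mcls p : nonunits (mcls f p) <-> vanish0 p.
Proof.
have [_ _ _ J4 _] := fl; split=> [Np|p0 [y]].
  apply: contrapT => /eqP c0; set c := p.@[_] in c0; apply: Np.
  (* Up to the scalar c, p is 1 + u with u^4 in the ideal, and the truncated geometric series
     inverts it. *)
  pose u := c^-1 *: p - 1.
  have u0 : vanish0 u by rewrite /vanish0 mevalB mevalZ meval1 mulVf ?subrr.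
  exists (mcls f (c^-1 *: (1 - u + u ^+ 2 - u ^+ 3))).
  rewrite -mclsM -(mcls1 f); apply/mcls_eq.
  have -> : p = c *: (1 + u) by rewrite /u addrC subrK scalerA divff ?scale1r.
  rewrite -scalerAl -scalerAr scalerA mulVf // scale1r.
  have -> : (1 - u + u ^+ 2 - u ^+ 3) * (1 + u) - 1 = - (u ^+ 3 * u) by ring.
  by apply: jacobian_idealN; apply: J4.
have [q ->] := mcls_surj y; rewrite -mclsM -(mcls1 f) => /mcls_eq J1.
have qp0 : vanish0 (q * p) by rewrite /vanish0 mevalM p0 mulr0.
apply: socle_functional_notin1; set r := q * p in J1 qp0.
(* Here r is congruent to 1 while r^4 is congruent to 0, which puts 1 in the ideal. *)
have -> : 1 = r ^+ 3 * r - (1 + r + r ^+ 2 + r ^+ 3) * (r - 1) by ring.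
by apply: jacobian_idealB; [apply: J4 | apply: jacobian_idealMl].
Qed.

Lemma socle_mcls p :
  socle (mcls f p) <-> forall q, vanish0 q -> jacobian_ideal f (q * p).
Proof.
split=> [Sp q q0|Jp y].
  have /Sp : nonunits (mcls f q) by apply/nonunits_mcls.
  by rewrite -mclsM -(mcls0 f) => /mcls_eq; rewrite subr0.
have [q ->] := mcls_surj y => /nonunits_mcls q0.
by rewrite -mclsM -(mcls0 f); apply/mcls_eq; rewrite subr0; apply: Jp.
Qed.

(** Since l kills the ideal, it descends to the quotient; the last clause on l makes the socle the
    line spanned by the Hessian, whence the bijection. *)
Lemma socle_functional_lift : exists w, socle_iso (f := f) w.
Proof.
have [lS lJ lH J4 [HJ lSoc]] := fl.
have lD a p q : l (a *: p + q) = a * l p + l q by apply: lS.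
pose w (x : {ideal_quot jacobian f}) := l (repr x).
have wE p : w (mcls f p) = l p.
  have /mcls_eq/lJ : mcls f (repr (mcls f p)) = mcls f p by rewrite /mcls reprK.
  by rewrite addrC -scaleN1r lD mulN1r addrC => /eqP; rewrite subr_eq0 => /eqP.
have SH : socle (mcls f (hessian f)) by apply/socle_mcls.
exists w; split=> //; last by rewrite wE.
- move=> c x y _ _; have [p ->] := mcls_surj x; have [q ->] := mcls_surj y.
  by rewrite -mclsM -mclsD !wE mul_mpolyC lD.
- split=> // [x y /set_mem + /set_mem|c _].
    have [p ->] := mcls_surj x; have [q ->] := mcls_surj y.
    move=> /socle_mcls/lSoc Jp /socle_mcls/lSoc Jq; rewrite !wE => lpq.
    apply/mcls_eq; have -> : p - q = (p - l p *: hessian f) - (q - l q *: hessian f).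
      by rewrite lpq; ring.
    exact: jacobian_idealB.
  exists (mcls f (c *: hessian f)); last first.
    by rewrite wE -[_ *: _]addr0 lD lH lJ ?jacobian_ideal0 // addr0 mulr1.
  apply/socle_mcls => q q0; rewrite -scalerAr -mul_mpolyC.
  exact/jacobian_idealMl/HJ.
Qed.

(** The cube of a linear form L lies in the socle, hence is congruent to l(L^3) times the Hessian,
    where every map satisfying [socle_iso] takes the value 1. So the choice made by [omega] does not
    matter. *)
Lemma associated_formE z :
  associated_form f z = l ((\sum_j z 0 j *: 'X_j) ^+ 3).
Proof.
have [lS lJ lH J4 [HJ lSoc]] := fl.
rewrite /associated_form; have [w wiso] := socle_functional_lift.
have : socle_iso (@omega _ f).
  by apply: (xgetPex (fun=> 0) (P := [set w | socle_iso w]%classic)); exists w.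
move: (@omega _ f) => {w wiso} w [wD _ SH wH].
have S0 : socle (0 : {ideal_quot jacobian f}) by move=> y _; rewrite mulr0.
have w0 : w 0 = 0.
  have := wD 1 0 0 S0 S0; rewrite mulr0 addr0 mul1r => h.
  by apply: (addrI (w 0)); rewrite addr0 -h.
set L := \sum_j z 0 j *: 'X_j.
have -> : \sum_j mcls f (z 0 j)%:MP * mcls f 'X_j = mcls f L.
  rewrite /L /mcls rmorph_sum; apply: eq_bigr => j _.
  by rewrite -mul_mpolyC rmorphM.
have -> : mcls f L ^+ 3 = mcls f (L ^+ 3) by rewrite /mcls rmorphXn.
have L0 : vanish0 L.
  by rewrite /vanish0 raddf_sum big1 // => j _; rewrite /= mevalZ mevalXU mulr0.
have -> : mcls f (L ^+ 3) = mcls f (l (L ^+ 3))%:MP * mcls f (hessian f) + 0.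
  rewrite addr0 -mclsM; apply/mcls_eq; rewrite mul_mpolyC; apply: lSoc => q q0.
  by rewrite mulrC; apply: J4.
by rewrite wD // wH w0 mulr1 addr0.
Qed.

End Functional.
End AssociatedForm.

(** * Linear substitutions: effect on derivatives, Hessians and Jacobian ideals *)

Lemma mpoly_alg_ind n (R : comNzRingType) (P : {mpoly R[n]} -> Prop) :
  (forall c, P c%:MP) -> (forall p q, P p -> P q -> P (p + q)) ->
  (forall i p, P p -> P ('X_i * p)) -> forall p, P p.
Proof.
move=> PC PD PX; suff PXm c m : P (c%:MP * 'X_[m]).
  elim/mpolyind => [|c m p _ _ IH]; first by rewrite -mpolyC0.
  by apply: PD; rewrite // -mul_mpolyC.
rewrite mpolyXE_id; elim: (index_enum _) => [|i r IH].
  by rewrite big_nil mulr1.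
rewrite big_cons mulrCA; elim: (m i) => [|k IHk]; first by rewrite mul1r.
by rewrite exprS -mulrA; apply: PX.
Qed.

Lemma mderivXU n (R : comNzRingType) (i j : 'I_n) :
  ('X_j : {mpoly R[n]})^`M(i) = (j == i)%:R.
Proof.
rewrite mderivX mnm1E; case: eqP => [->|_]; last by rewrite scale0r.
rewrite scale1r (_ : U_(i) - U_(i) = 0)%MM ?mpolyX0 //.
by apply/mnmP => k; rewrite mnmBE subnn mnmE.
Qed.

Lemma comp_mpolyM n k (R : comNzRingType) (lq : n.-tuple {mpoly R[k]}) :
  {morph comp_mpoly lq : p q / p * q}.
Proof. exact: rmorphM. Qed.

(** Same shape as the tuple in [act_poly], so that [act C] is by conversion the substitution of
    [invmx C]. *)
Definition mx_forms (K : fieldType) (M : 'M[K]_3) : 3.-tuple {mpoly K[3]} :=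
  [tuple \sum_(k < 3) M j k *: 'X_k | j < 3].

Local Notation subst_mx M := (comp_mpoly (mx_forms M)).

Section Substitution.
Variable K : fieldType.
Implicit Types (M N C : 'M[K]_3) (p : {mpoly K[3]}) (f : cubic K).

Lemma subst_mxC M c : subst_mx M c%:MP = c%:MP.
Proof. exact: comp_mpolyC. Qed.

Lemma subst_mxX M i : subst_mx M 'X_i = \sum_(k < 3) M i k *: 'X_k.
Proof. by rewrite comp_mpolyXU -tnth_nth tnth_mktuple. Qed.

Lemma subst_mx_linear_form M (v : 'rV[K]_3) :
  subst_mx M (\sum_j v 0 j *: 'X_j) = \sum_j (v *m M) 0 j *: 'X_j.
Proof.
rewrite rmorph_sum /=; under eq_bigr => j _ do rewrite linearZ /= subst_mxX scaler_sumr.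
rewrite exchange_big; apply: eq_bigr => k _.
by rewrite mxE scaler_suml; apply: eq_bigr => j _; rewrite scalerA.
Qed.

Lemma subst_mx1 p : subst_mx 1%:M p = p.
Proof.
elim/mpoly_alg_ind: p => [c|p q IHp IHq|i p IH]; first exact: subst_mxC.
  by rewrite rmorphD /= IHp IHq.
rewrite rmorphM /= IH subst_mxX (bigD1 i) //= big1 ?addr0 => [|k ki].
  by rewrite mxE eqxx scale1r.
by rewrite mxE eq_sym (negPf ki) scale0r.
Qed.

Lemma subst_mxM M N p : subst_mx M (subst_mx N p) = subst_mx (N *m M) p.
Proof.
elim/mpoly_alg_ind: p => [c|p q IHp IHq|i p IH]; first by rewrite !subst_mxC.
  by rewrite !rmorphD /= IHp IHq.
rewrite [X in subst_mx M X]comp_mpolyM [LHS]comp_mpolyM [RHS]comp_mpolyM.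
rewrite IH; apply: (congr1 (fun q => q * subst_mx (N *m M) p)).
have rE (A : 'M[K]_3) : subst_mx A 'X_i = \sum_j (row i A) 0 j *: 'X_j.
  by rewrite subst_mxX; apply: eq_bigr => k _; rewrite mxE.
by rewrite !rE subst_mx_linear_form row_mul.
Qed.

Lemma meval_subst_mx0 M p : vanish0 (subst_mx M p) <-> vanish0 p.
Proof.
rewrite /vanish0 comp_mpoly_meval.
rewrite (_ : _.@[_] = p.@[fun=> 0]) //; apply: meval_eq => i.
rewrite tnth_mktuple raddf_sum big1 // => k _.
by rewrite /= mevalZ mevalXU mulr0.
Qed.

(** Chain rule; both sides obey the same Leibniz rule, which reduces it to the variables. *)
Lemma mderiv_subst_mx M p i :
  (subst_mx M p)^`M(i) = \sum_k M k i *: subst_mx M p^`M(k).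
Proof.
elim/mpoly_alg_ind: p => [c|p q IHp IHq|j p IH].
- rewrite subst_mxC mderivC big1 // => k _.
  by rewrite mderivC rmorph0 scaler0.
- rewrite rmorphD mderivD IHp IHq -big_split; apply: eq_bigr => k _ /=.
  by rewrite mderivD rmorphD scalerDr.
rewrite rmorphM mderivM /= IH.
have -> : (subst_mx M 'X_j)^`M(i) = (M j i)%:MP.
  rewrite subst_mxX raddf_sum (bigD1 i) //= big1 ?addr0 => [|k ki].
    by rewrite mderivZ mderivXU eqxx -mul_mpolyC mulr1.
  by rewrite mderivZ mderivXU (negPf ki) scaler0.
rewrite [X in _ + X]mulr_sumr.
under [RHS]eq_bigr => k _ do rewrite mderivM rmorphD rmorphM scalerDr /=.
rewrite big_split /=; congr (_ + _); last first.
  by apply: eq_bigr => k _; rewrite comp_mpolyM scalerAr.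
rewrite (bigD1 j) //= big1 ?addr0 => [|k kj].
  by rewrite mderivXU eqxx rmorph1 mul1r mul_mpolyC.
by rewrite mderivXU eq_sym (negPf kj) rmorph0 mul0r scaler0.
Qed.

(** Two applications of the chain rule turn the matrix of second derivatives into B^T H B, whence
    the square of the determinant. *)
Lemma hessian_act C f :
  hessian (act C f) = \det (invmx C) ^+ 2 *: subst_mx (invmx C) (hessian f).
Proof.
set M := invmx C; rewrite /hessian -mul_mpolyC rmorphXn /=.
pose B := map_mx (@mpolyC 3 K) M.
have -> : (\det M)%:MP = \det B by rewrite det_map_mx.
rewrite -det_map_mx; set H := map_mx _ _.
have -> : (\matrix_(i, j) (act C f : {mpoly K[3]})^`M(i)^`M(j)) = B^T *m H *m B.
  apply/matrixP => i j; rewrite !mxE.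
  rewrite [X in X^`M(i)](_ : _ = subst_mx M f) // mderiv_subst_mx.
  rewrite raddf_sum /=.
  under eq_bigr => k _ do rewrite mderivZ mderiv_subst_mx scaler_sumr.
  rewrite exchange_big; apply: eq_bigr => k _; rewrite !mxE mulr_suml.
  apply: eq_bigr => l _; rewrite !mxE -!mul_mpolyC. ring.
rewrite (det_mulmx _ B) (det_mulmx B^T) det_tr.
by move: (\det B) (\det H) => b h; rewrite mulrAC.
Qed.

(** Inverts the chain rule: the substituted partial derivatives of f are recovered as combinations
    of those of [act C f]. *)
Lemma lin_comb_mulmx1 n (V : lmodType K) (A B : 'M[K]_n) (g : 'I_n -> V) j :
  A *m B = 1%:M -> \sum_i B i j *: (\sum_k A k i *: g k) = g j.
Proof.
move=> AB1; under eq_bigr => i _ do rewrite scaler_sumr.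
rewrite exchange_big /=; under eq_bigr => k _.
  under eq_bigr => i _ do rewrite scalerA mulrC.
  rewrite -scaler_suml (_ : \sum_i _ = (A *m B) k j); last by rewrite mxE.
  over.
rewrite AB1 (bigD1 j) //= big1 ?addr0 => [|k /negPf kj].
  by rewrite mxE eqxx scale1r.
by rewrite mxE kj scale0r.
Qed.

Lemma jacobian_ideal_act C f p : C \in unitmx ->
  jacobian_ideal f p -> jacobian_ideal (act C f) (subst_mx (invmx C) p).
Proof.
move=> Cu /jacobian_idealP[a ->]; apply/jacobian_idealP.
exists (fun i => \sum_j C i j *: subst_mx (invmx C) (a j)).
rewrite rmorph_sum /=; under [RHS]eq_bigr => i _ do rewrite mulr_suml.
rewrite exchange_big; apply: eq_bigr => j _ /=.
rewrite comp_mpolyM.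
have /esym-> := lin_comb_mulmx1 (fun k => subst_mx (invmx C) f^`M(k)) j (mulVmx Cu).
rewrite mulr_sumr; apply: eq_bigr => i _; rewrite -scalerAl -scalerAr.
by congr (_ *: (_ * _)); apply/esym/mderiv_subst_mx.
Qed.

Lemma act_actV C f : C \in unitmx -> act (invmx C) (act C f) = f.
Proof.
move=> Cu; apply: val_inj.
rewrite /= [LHS](_ : _ = subst_mx (invmx (invmx C)) (subst_mx (invmx C) f)) //.
by rewrite subst_mxM invmxK mulVmx // subst_mx1.
Qed.

Lemma jacobian_ideal_actV C f p : C \in unitmx ->
  jacobian_ideal (act C f) p -> jacobian_ideal f (subst_mx C p).
Proof.
move=> Cu; have := @jacobian_ideal_act (invmx C) (act C f) p.
by rewrite unitmx_inv invmxK act_actV //; apply.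
Qed.

Lemma subst_mxK C p : C \in unitmx -> subst_mx (invmx C) (subst_mx C p) = p.
Proof. by move=> Cu; rewrite subst_mxM mulmxV // subst_mx1. Qed.

Lemma subst_mxVK C p : C \in unitmx -> subst_mx C (subst_mx (invmx C) p) = p.
Proof. by move=> Cu; rewrite subst_mxM mulVmx // subst_mx1. Qed.

(** The factor [\det C ^+ 2] compensates the weight of the Hessian; all other clauses concern
    ideals, which substitution by C or its inverse carries to one another. *)
Lemma socle_functional_act C f l : C \in unitmx -> socle_functional f l ->
  socle_functional (act C f) (fun p => \det C ^+ 2 * l (subst_mx C p)).
Proof.
move=> Cu [lS lJ lH J4 [HJ lSoc]].
have C0 : \det C != 0 by rewrite -unitfE -unitmxE.
have lZ a p : l (a *: p) = a * l p.
  by have := lS a p 0; rewrite addr0 (lJ 0) ?jacobian_ideal0 // addr0.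
have HE : hessian (act C f) = \det C ^- 2 *: subst_mx (invmx C) (hessian f).
  by rewrite hessian_act det_inv exprVn.
have HE' : hessian (act C f) = subst_mx (invmx C) (\det C ^- 2 *: hessian f).
  by rewrite HE [RHS]linearZ.
have van p : vanish0 p -> vanish0 (subst_mx C p) by move/meval_subst_mx0; apply.
split.
- by move=> a p q; rewrite linearP /= lS; ring.
- by move=> p /jacobian_ideal_actV/lJ -> //; rewrite mulr0.
- by rewrite HE' subst_mxVK // lZ lH; field.
- move=> p q p0 q0; rewrite -[X in jacobian_ideal _ X](subst_mxK _ Cu).
  apply: jacobian_ideal_act => //; rewrite rmorphM rmorphXn /=.
  by apply: J4; apply: van.
split=> [q q0|p Jp].
  rewrite -[q](subst_mxK _ Cu) HE' -rmorphM; apply: jacobian_ideal_act => //.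
  by rewrite -scalerAr -mul_mpolyC; apply/jacobian_idealMl/HJ/van.
rewrite -[X in jacobian_ideal _ X](subst_mxK _ Cu); apply: jacobian_ideal_act => //.
rewrite comp_mpolyB comp_mpolyZ HE' subst_mxVK // scalerA -mulrA mulrCA.
rewrite divff ?expf_neq0 // mulr1; apply: lSoc => q q0.
rewrite -[q](subst_mxVK _ Cu) -rmorphM; apply: jacobian_ideal_actV => //.
by apply: Jp; apply/meval_subst_mx0.
Qed.

(** Substituting C turns the linear form of [dual_act C z] into that of z, so only the normalising
    factor of the transported functional remains. *)
Lemma associated_form_act C f l z : C \in unitmx -> socle_functional f l ->
  associated_form (act C f) (dual_act C z) = \det C ^+ 2 * associated_form f z.
Proof.
move=> Cu fl; rewrite (associated_formE (socle_functional_act Cu fl)).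
rewrite (associated_formE fl) rmorphXn /= subst_mx_linear_form.
by rewrite /dual_act mulmxKV.
Qed.

End Substitution.

(** * Indices, sums and determinants in dimension three *)

Lemma ord3_ind (P : 'I_3 -> Prop) : P 0 -> P 1 -> P 2 -> forall i, P i.
Proof.
by move=> P0 P1 P2 [[|[|[|//]]] i]; [move: P0 | move: P1 | move: P2];
   congr P; apply: val_inj.
Qed.

Lemma sum_ord3 (V : nmodType) (F : 'I_3 -> V) : \sum_i F i = F 0 + F 1 + F 2.
Proof.
rewrite !big_ord_recl big_ord0 addr0 addrA.
by congr (F _ + F _ + F _); apply: val_inj.
Qed.

Lemma det_mx22 (R : comNzRingType) (A : 'M[R]_2) :
  \det A = A 0 0 * A 1 1 - A 0 1 * A 1 0.
Proof.
rewrite (expand_det_row _ 0) !big_ord_recl big_ord0 addr0 /cofactor !det_mx11 !mxE.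
have L (i j : 'I_2) (k : 'I_1) : val j = bump i k -> lift i k = j.
  by move=> h; apply: val_inj.
rewrite (L 0 1 0) // (L _ 0 0) //=.
by rewrite /= expr0 expr1 mul1r mulN1r mulrN.
Qed.

Lemma det_mx33 (R : comNzRingType) (A : 'M[R]_3) :
  \det A = A 0 0 * (A 1 1 * A 2 2 - A 1 2 * A 2 1)
         - A 0 1 * (A 1 0 * A 2 2 - A 1 2 * A 2 0)
         + A 0 2 * (A 1 0 * A 2 1 - A 1 1 * A 2 0).
Proof.
rewrite (expand_det_row _ 0) sum_ord3 /cofactor !det_mx22 !mxE.
have L (i : 'I_3) (j : 'I_2) (k : 'I_3) : val k = bump i j -> lift i j = k.
  by move=> h; apply: val_inj.
rewrite (L 0 0 1) // (L 0 1 2) // (L 1 0 0) // (L 1 1 2) // (L 2 0 0) // (L 2 1 1) //=.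
by rewrite !expr0 !mul1r add0n expr1 expr2 mulrNN mulr1; ring.
Qed.

Definition ord3_eqE := (eqxx,
 (erefl : ((0 : 'I_3) == 1) = false), (erefl : ((0 : 'I_3) == 2) = false),
 (erefl : ((1 : 'I_3) == 0) = false), (erefl : ((1 : 'I_3) == 2) = false),
 (erefl : ((2 : 'I_3) == 0) = false), (erefl : ((2 : 'I_3) == 1) = false)).

Lemma ord3_oppD (a b c : 'I_3) : val (- (a + b)) = val c -> - (a + b) = c.
Proof. exact: val_inj. Qed.

(** The table of -(i + j) in Z/3: the index i itself when i = j, the third index otherwise. *)
Definition ord3_oppDE := (@ord3_oppD 0 0 0 erefl,
  @ord3_oppD 0 1 2 erefl,
  @ord3_oppD 0 2 1 erefl,
  @ord3_oppD 1 0 2 erefl,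
  @ord3_oppD 1 1 1 erefl,
  @ord3_oppD 1 2 0 erefl,
  @ord3_oppD 2 0 1 erefl,
  @ord3_oppD 2 1 0 erefl,
  @ord3_oppD 2 2 2 erefl).

(** * The Jacobian ideal of a cubic in the Hesse pencil *)

Section HessePencil.
Variable K : numFieldType.
Variables (f : cubic K) (d : K).
Hypothesis fE : hesse_form f 1 1 1 d.
Hypothesis d_ndeg : 1 + 8 * d ^+ 3 != 0.

Local Notation x := ('X_0 : {mpoly K[3]}).
Local Notation y := ('X_1 : {mpoly K[3]}).
Local Notation z := ('X_2 : {mpoly K[3]}).
Local Notation J := (jacobian_ideal f).
Local Notation E := ((2 * d)%:MP : {mpoly K[3]}).

Definition mderivE := (mderivD, mderivM, mderivZ, mderivXU, mderivC).

Lemma hesse_formE : (f : {mpoly K[3]}) = x ^+ 3 + y ^+ 3 + z ^+ 3 + 3 * E * (x * y * z).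
Proof.
rewrite [LHS]fE !scale1r -mul_mpolyC; congr (_ + _ * _).
by rewrite (_ : 6 * d = 3 * (2 * d)) ?mpolyCM ?mpolyC_nat //; ring.
Qed.

Lemma mderiv_hesse0 : f^`M(0) = 3 * (x ^+ 2 + E * (y * z)).
Proof.
rewrite hesse_formE !exprS !expr0 -[3]mpolyC_nat !mderivE !ord3_eqE /=; ring.
Qed.

Lemma mderiv_hesse1 : f^`M(1) = 3 * (y ^+ 2 + E * (x * z)).
Proof.
rewrite hesse_formE !exprS !expr0 -[3]mpolyC_nat !mderivE !ord3_eqE /=; ring.
Qed.

Lemma mderiv_hesse2 : f^`M(2) = 3 * (z ^+ 2 + E * (x * y)).
Proof.
rewrite hesse_formE !exprS !expr0 -[3]mpolyC_nat !mderivE !ord3_eqE /=; ring.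
Qed.


(* i + j + k = 0 in Z/3 exactly when i, j, k are all equal or all distinct. *)
Lemma mderiv2_hesse i j :
  f^`M(i)^`M(j) = (if i == j then 6 else 6 * d)%:MP * 'X_(- (i + j)).
Proof.
elim/ord3_ind: i; elim/ord3_ind: j;
  rewrite (mderiv_hesse0, mderiv_hesse1, mderiv_hesse2) -[3]mpolyC_nat !exprS !expr0;
  rewrite !mderivE !ord3_eqE;
  rewrite ord3_oppDE.
all: rewrite ?mpolyCM ?mpolyC_nat /=.
all: ring.
Qed.

Local Notation zp := (fun _ : 'I_3 => 0 : K).

(* The triple derivatives at 0 are the coefficients of X_0 X_1 X_2 and, up to the
   factor 6, of the X_i^3; in this form the Leibniz rule applies. *)
Definition hesse_pairing (p : {mpoly K[3]}) : K :=
  (p^`M(0)^`M(1)^`M(2)).@[zp] - d / 3 * ((p^`M(0)^`M(0)^`M(0)).@[zp]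
    + (p^`M(1)^`M(1)^`M(1)).@[zp] + (p^`M(2)^`M(2)^`M(2)).@[zp]).

Lemma hesse_pairing_linear : scalar hesse_pairing.
Proof.
have lin i j k : scalar (fun p : {mpoly K[3]} => (p^`M(i)^`M(j)^`M(k)).@[zp]).
  by move=> a p q; rewrite !(mderivD, mderivZ) mevalD mevalZ.
move=> a p q; rewrite /hesse_pairing !lin.
do 4 move: (_.@[_]) => ?.
by do 4 move: (_.@[_]) => ?; ring.
Qed.

Let simp := (mulr1n, mulr0n, mulr1, mul1r, mulr0, mul0r, addr0, add0r, mderiv0,
  expr1, expr0, mderivC).

Lemma hesse_pairing_xyz : hesse_pairing (x * y * z) = 1.
Proof.
have D0 : (x * y * z)^`M(0) = y * z.
  by rewrite !mderivM !mderivXU !ord3_eqE !simp.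
have D1 : (x * y * z)^`M(1) = x * z.
  by rewrite !mderivM !mderivXU !ord3_eqE !simp.
have D2 : (x * y * z)^`M(2) = x * y.
  by rewrite !mderivM !mderivXU !ord3_eqE !simp.
rewrite /hesse_pairing D0 D1 D2 !mderivM !mderivXU !ord3_eqE !simp.
by rewrite !mderivXU !ord3_eqE !simp !meval0 meval1 !simp subr0.
Qed.

(** In the Leibniz expansion at the origin only the terms with exactly two derivatives on b survive,
    as for a quadratic form b. *)
Lemma meval_mderiv3M (a b : {mpoly K[3]}) i j k (g : 'I_3 -> 'I_3 -> K) :
  b.@[zp] = 0 -> (forall i, b^`M(i).@[zp] = 0) ->
  (forall i j, b^`M(i)^`M(j) = (g i j)%:MP) ->
  (a * b)^`M(i)^`M(j)^`M(k).@[zp] =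
    a^`M(i).@[zp] * g j k + a^`M(j).@[zp] * g i k + a^`M(k).@[zp] * g i j.
Proof.
move=> b0 b1 b2; rewrite !(mderivM, mderivD) !b2 !mderivC !mevalD !mevalM.
rewrite b0 !b1 !mevalC. ring.
Qed.

(** Only the linear part of the cofactor a matters. The weight d / 3 is forced by x times the
    x-derivative of f, that is 3 x^3 + 6 d xyz, whose two contributions must cancel. *)
Lemma hesse_pairing_jacobian p : J p -> hesse_pairing p = 0.
Proof.
suff G0 i a : hesse_pairing (a * f^`M(i)) = 0.
  move=> /jacobian_idealP[a ->]; rewrite sum_ord3.
  have lD b q : hesse_pairing (b + q) = hesse_pairing b + hesse_pairing q.
    by rewrite -[b]scale1r hesse_pairing_linear scale1r mul1r.
  by rewrite !lD !G0 !addr0.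
pose g (j k : 'I_3) : K := (if i == j then 6 else 6 * d) *+ (k == - (i + j)).
have f0 : (f^`M(i)).@[zp] = 0.
  by clear g; elim/ord3_ind: i; rewrite (mderiv_hesse0, mderiv_hesse1, mderiv_hesse2);
     rewrite !(mevalM, mevalD, mevalXU); ring.
have f1 j : (f^`M(i)^`M(j)).@[zp] = 0.
  by rewrite mderiv2_hesse mevalM mevalXU mulr0.
have f2 j k : f^`M(i)^`M(j)^`M(k) = (g j k)%:MP.
  rewrite mderiv2_hesse mderivM mderivC mul0r add0r mderivXU /g.
  by rewrite mulr_natr raddfMn /= [k == _]eq_sym.
rewrite /hesse_pairing !(meval_mderiv3M _ _ _ _ f0 f1 f2).
rewrite /g; clear g f0 f1 f2.
by elim/ord3_ind: i; rewrite !ord3_oppDE !ord3_eqE /= !mulr1n !mulr0n; field.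
Qed.

(** Lets an explicit combination of known members be supplied first, leaving a polynomial identity
    to [ring]. *)
Lemma jacobian_ideal_eq p q : J p -> p = q -> J q.
Proof. by move=> Jp <-. Qed.

Lemma jacobian_ideal_cst (c : K) p : c != 0 -> J (c%:MP * p) -> J p.
Proof.
move=> c0 /(jacobian_idealMl c^-1%:MP).
by rewrite mulrA -mpolyCM mulVf // mul1r.
Qed.

Lemma jacobian_hesse_gen :
  [/\ J (x ^+ 2 + E * (y * z)), J (y ^+ 2 + E * (x * z)) & J (z ^+ 2 + E * (x * y))].
Proof.
have JD i : J f^`M(i).
  apply/jacobian_idealP; exists (fun j => (j == i)%:R).
  by rewrite (bigD1 i) //= big1 ?addr0 ?eqxx ?mul1r // => j /negPf->; rewrite mul0r.
have n3 : (3 : K) != 0 by rewrite pnatr_eq0.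
split; apply: (jacobian_ideal_cst n3); rewrite mpolyC_nat.
- by rewrite -mderiv_hesse0.
- by rewrite -mderiv_hesse1.
- by rewrite -mderiv_hesse2.
Qed.

(** Going round the three relations, u^2 v = - E v^2 w = E^2 u w^2 = - E^3 u^2 v modulo the ideal.
    So (1 + E^3) u^2 v is in the ideal, and 1 + E^3 is the nonzero constant 1 + 8 d^3. *)
Lemma jacobian_ideal_sqM (u v w : {mpoly K[3]}) :
  J (u ^+ 2 + E * (v * w)) -> J (v ^+ 2 + E * (u * w)) -> J (w ^+ 2 + E * (u * v)) ->
  J (u ^+ 2 * v).
Proof.
move=> Ju Jv Jw; apply: (jacobian_ideal_cst d_ndeg).
have -> : (1 + 8 * d ^+ 3)%:MP = 1 + E ^+ 3 :> {mpoly K[3]}.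
  by rewrite (_ : 8 * d ^+ 3 = (2 * d) ^+ 3) ?mpolyCD ?mpolyC1 ?rmorphXn //; ring.
apply: (@jacobian_ideal_eq (v * (u ^+ 2 + E * (v * w))
   - E * w * (v ^+ 2 + E * (u * w)) + E ^+ 2 * u * (w ^+ 2 + E * (u * v)))); last by ring.
apply: jacobian_idealD; last exact: jacobian_idealMl.
by apply: jacobian_idealB; apply: jacobian_idealMl.
Qed.

Lemma jacobian_hesse_sqM i j : i != j -> J ('X_i ^+ 2 * 'X_j).
Proof.
have [Jx Jy Jz] := jacobian_hesse_gen.
have Jx' : J (x ^+ 2 + E * (z * y)) by rewrite [z * y]mulrC.
have Jy' : J (y ^+ 2 + E * (z * x)) by rewrite [z * x]mulrC.
have Jz' : J (z ^+ 2 + E * (y * x)) by rewrite [y * x]mulrC.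
by elim/ord3_ind: i; elim/ord3_ind: j; rewrite ?eqxx // => _;
   apply: jacobian_ideal_sqM; eassumption.
Qed.

Lemma jacobian_hesse_cube i : J ('X_i ^+ 3 + E * (x * y * z)).
Proof.
have [Jx Jy Jz] := jacobian_hesse_gen.
elim/ord3_ind: i.
- by apply: (jacobian_ideal_eq (jacobian_idealMl x Jx)); ring.
- by apply: (jacobian_ideal_eq (jacobian_idealMl y Jy)); ring.
- by apply: (jacobian_ideal_eq (jacobian_idealMl z Jz)); ring.
Qed.

Lemma jacobian_hesse_Mxyz i : J ('X_i * (x * y * z)).
Proof.
elim/ord3_ind: i.
- have Jz := jacobian_hesse_sqM (erefl : (0 : 'I_3) != 1).
  by apply: (jacobian_ideal_eq (jacobian_idealMl z Jz)); ring.
- have Jz := jacobian_hesse_sqM (erefl : (1 : 'I_3) != 0).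
  by apply: (jacobian_ideal_eq (jacobian_idealMl z Jz)); ring.
- have Jx := jacobian_hesse_sqM (erefl : (2 : 'I_3) != 1).
  by apply: (jacobian_ideal_eq (jacobian_idealMl x Jx)); ring.
Qed.

Lemma jacobian_vanish0M s q : (forall i, J ('X_i * s)) -> vanish0 q -> J (q * s).
Proof.
(* Generalised to arbitrary q by subtracting its constant term, which makes the induction go
   through. *)
move=> Js q0; suff : J (q * s - q.@[zp]%:MP * s) by rewrite q0 mul0r subr0.
elim/mpoly_alg_ind: q {q0} => [c|p q Jp Jq|i p _].
- by rewrite mevalC subrr jacobian_ideal0.
- rewrite mevalD mpolyCD; apply: (jacobian_ideal_eq (jacobian_idealD Jp Jq)); ring.
- rewrite mevalM mevalXU mul0r mul0r subr0 mulrAC mulrC; exact: jacobian_idealMl.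
Qed.

Lemma jacobian_hesse_deg3 i j k :
  exists c : K, J ('X_i * ('X_j * 'X_k) - c%:MP * (x * y * z)).
Proof.
have [eij|nij] := eqVneq i j.
  subst j; have [<-|nik] := eqVneq i k.
    exists (- (2 * d)); apply: (jacobian_ideal_eq (jacobian_hesse_cube i)).
    by rewrite mpolyCN; ring.
  by exists 0; apply: (jacobian_ideal_eq (jacobian_hesse_sqM nik)); rewrite mpolyC0; ring.
have [<-|nik] := eqVneq i k.
  by exists 0; apply: (jacobian_ideal_eq (jacobian_hesse_sqM nij)); rewrite mpolyC0; ring.
have [ejk|njk] := eqVneq j k.
  subst k; exists 0; apply: (@jacobian_ideal_eq ('X_j ^+ 2 * 'X_i)).
    by apply: jacobian_hesse_sqM; rewrite eq_sym.
  by rewrite mpolyC0; ring.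
exists 1; apply: (jacobian_ideal_eq (jacobian_ideal0 f)); rewrite mpolyC1.
move: i j k nij nik njk.
by do 3 (elim/ord3_ind); rewrite ?eqxx // => _ _ _; ring.
Qed.

(** The factors are replaced one at a time by variables. Three variables give a multiple of xyz
    modulo the ideal, and a fourth one kills xyz. *)
Lemma jacobian_hesse_deg4 p q : vanish0 p -> vanish0 q -> J (p ^+ 3 * q).
Proof.
move=> p0 q0; rewrite mulrC !exprS expr0 mulr1.
apply: jacobian_vanish0M q0 => l; rewrite mulrCA.
apply: jacobian_vanish0M (p0) => k.
have -> : 'X_k * ('X_l * (p * p)) = p * ('X_k * ('X_l * p)) by ring.
apply: jacobian_vanish0M (p0) => j.
have -> : 'X_j * ('X_k * ('X_l * p)) = p * ('X_j * ('X_k * 'X_l)) by ring.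
apply: jacobian_vanish0M (p0) => i.
have [c Jc] := jacobian_hesse_deg3 j k l.
apply: (@jacobian_ideal_eq ('X_i * ('X_j * ('X_k * 'X_l) - c%:MP * (x * y * z))
  + c%:MP * ('X_i * (x * y * z)))).
  by apply: jacobian_idealD; apply: jacobian_idealMl => //; apply: jacobian_hesse_Mxyz.
ring.
Qed.

(** The eight squarefree monomials span the Milnor algebra, because their span is stable under
    multiplication by each variable. *)
Lemma jacobian_hesse_normal p :
  exists a b0 b1 b2 g0 g1 g2 c : K,
   J (p - (a%:MP + b0%:MP * x + b1%:MP * y + b2%:MP * z
           + g0%:MP * (y * z) + g1%:MP * (x * z) + g2%:MP * (x * y) + c%:MP * (x * y * z))).
Proof.
have [Jx Jy Jz] := jacobian_hesse_gen.
have S i j := @jacobian_hesse_sqM i j.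
elim/mpoly_alg_ind: p => [c|p q [a [b0 [b1 [b2 [g0 [g1 [g2 [c Jp]]]]]]]]
  [a' [b0' [b1' [b2' [g0' [g1' [g2' [c' Jq]]]]]]]]|i p].
- exists c, 0, 0, 0, 0, 0, 0, 0; apply: (jacobian_ideal_eq (jacobian_ideal0 f)).
  by rewrite mpolyC0; ring.
- exists (a + a'), (b0 + b0'), (b1 + b1'), (b2 + b2').
  exists (g0 + g0'), (g1 + g1'), (g2 + g2'), (c + c').
  by apply: (jacobian_ideal_eq (jacobian_idealD Jp Jq)); rewrite !mpolyCD; ring.
move=> [a [b0 [b1 [b2 [g0 [g1 [g2 [c]]]]]]]] /(jacobian_idealMl 'X_i).
have := jacobian_idealMl c%:MP (jacobian_hesse_Mxyz i).
elim/ord3_ind: i => J1 J2.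
(* Multiplying by x shifts the coefficients, rewrites x^2 as - 2 d yz, and kills x^2 z, x^2 y and
   x^2 yz. *)
- exists 0, a, 0, 0, (- (2 * d * b0)), b2, b1, g0.
  apply: (jacobian_ideal_eq (jacobian_idealD J2 (jacobian_idealD J1 (jacobian_idealD
   (jacobian_idealMl b0%:MP Jx) (jacobian_idealD (jacobian_idealMl g1%:MP (S 0 2 erefl))
    (jacobian_idealMl g2%:MP (S 0 1 erefl))))))).
  by rewrite mpolyC0 mpolyCN (mpolyCM _ (2 * d)); ring.
- exists 0, 0, a, 0, b2, (- (2 * d * b1)), b0, g1.
  apply: (jacobian_ideal_eq (jacobian_idealD J2 (jacobian_idealD J1 (jacobian_idealD
   (jacobian_idealMl b1%:MP Jy) (jacobian_idealD (jacobian_idealMl g0%:MP (S 1 2 erefl))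
    (jacobian_idealMl g2%:MP (S 1 0 erefl))))))).
  by rewrite mpolyC0 mpolyCN (mpolyCM _ (2 * d)); ring.
- exists 0, 0, 0, a, b1, b0, (- (2 * d * b2)), g2.
  apply: (jacobian_ideal_eq (jacobian_idealD J2 (jacobian_idealD J1 (jacobian_idealD
   (jacobian_idealMl b2%:MP Jz) (jacobian_idealD (jacobian_idealMl g0%:MP (S 2 1 erefl))
    (jacobian_idealMl g1%:MP (S 2 0 erefl))))))).
  by rewrite mpolyC0 mpolyCN (mpolyCM _ (2 * d)); ring.
Qed.

(** The determinant is 216 ((1 + 2 d^3) xyz - d^2 (x^3 + y^3 + z^3)), and each cube is - 2 d xyz
    modulo the ideal; the multiplier - 54 E^2 is - 216 d^2. *)
Lemma hessian_hesse : J (hessian f - (216 * (1 + 8 * d ^+ 3))%:MP * (x * y * z)).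
Proof.
rewrite /hessian det_mx33 !mxE !mderiv2_hesse !ord3_eqE !ord3_oppDE.
apply: (jacobian_ideal_eq (jacobian_idealMl (- 54 * E ^+ 2) (jacobian_idealD
  (jacobian_hesse_cube 0) (jacobian_idealD (jacobian_hesse_cube 1) (jacobian_hesse_cube 2))))).
have -> : (6 * d)%:MP = 3 * E :> {mpoly K[3]}.
  by rewrite (_ : 6 * d = 3 * (2 * d)) ?(mpolyCM _ 3) ?mpolyC_nat //; ring.
have -> : 216 * (1 + 8 * d ^+ 3) = 216 * (1 + (2 * d) ^+ 3) by ring.
have -> : (216 * (1 + (2 * d) ^+ 3))%:MP = 216 * (1 + E ^+ 3) :> {mpoly K[3]}.
  by rewrite (mpolyCM _ 216) (mpolyC_nat 3 K 216) (mpolyCD _ 1) mpolyC1 rmorphXn.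
by rewrite (mpolyC_nat 3 K 6); ring.
Qed.

End HessePencil.

(** * Socle functional and associated form of a Hesse cubic *)

Section HesseAssociatedForm.
Variable K : numFieldType.
Variables (f : cubic K) (d : K).
Hypothesis fE : hesse_form f 1 1 1 d.
Hypothesis d_ndeg : 1 + 8 * d ^+ 3 != 0.

Local Notation x := ('X_0 : {mpoly K[3]}).
Local Notation y := ('X_1 : {mpoly K[3]}).
Local Notation z := ('X_2 : {mpoly K[3]}).
Local Notation J := (jacobian_ideal f).
Local Notation h := (216 * (1 + 8 * d ^+ 3)).

Lemma hesse_pairing_mod p c : J (p - c%:MP * (x * y * z)) -> hesse_pairing d p = c.
Proof.
move=> /(hesse_pairing_jacobian fE).
rewrite addrC mul_mpolyC -scaleNr hesse_pairing_linear hesse_pairing_xyz.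
by rewrite mulr1 addrC => /eqP; rewrite subr_eq0 => /eqP.
Qed.

(** The substantial clause is the last one. An element killed by the variables is put in normal
    form, and multiplication by complementary monomials shows that all coefficients but that of xyz
    are zero. *)
Lemma socle_functional_hesse :
  socle_functional f (fun p => h^-1 * hesse_pairing d p).
Proof.
have h0 : h != 0 by rewrite mulf_neq0 // pnatr_eq0.
have HJ := hessian_hesse fE.
have Mxyz := jacobian_hesse_Mxyz fE d_ndeg.
have M0 q : vanish0 q -> J (q * (x * y * z)) by apply: jacobian_vanish0M.
split.
- by move=> a p q; rewrite hesse_pairing_linear; ring.
- by move=> p /(hesse_pairing_jacobian fE) ->; rewrite mulr0.
- by rewrite (hesse_pairing_mod HJ) mulVf.
- exact: (jacobian_hesse_deg4 fE d_ndeg).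
split=> [q q0|p Jp].
  apply: (@jacobian_ideal_eq _ _ (q * (hessian f - h%:MP * (x * y * z))
    + h%:MP * (q * (x * y * z)))).
    by apply: jacobian_idealD; apply: jacobian_idealMl => //; apply: M0.
  by ring.
have [a [b0 [b1 [b2 [g0 [g1 [g2 [c JN]]]]]]]] := jacobian_hesse_normal fE d_ndeg p.
have v i (q : {mpoly K[3]}) : vanish0 ('X_i * q) by rewrite /vanish0 mevalM mevalXU mul0r.
have S i j := @jacobian_hesse_sqM _ _ _ fE d_ndeg i j.
have [Jx Jy Jz] := jacobian_hesse_gen fE.
have N q : vanish0 q -> J (q * (a%:MP + b0%:MP * x + b1%:MP * y + b2%:MP * z
           + g0%:MP * (y * z) + g1%:MP * (x * z) + g2%:MP * (x * y) + c%:MP * (x * y * z))).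
  move=> q0; have := jacobian_idealB (Jp q q0) (jacobian_idealMl q JN).
  by move/jacobian_ideal_eq; apply; ring.
(* The functional shows that a member of the ideal congruent to e xyz has e = 0; each coefficient
   below is obtained as such an e. *)
have cf r e : J r -> J (r - e%:MP * (x * y * z)) -> e = 0.
  by move=> /(hesse_pairing_jacobian fE) r0 /hesse_pairing_mod; rewrite r0.
have D := @jacobian_idealD _ f; have M k := @jacobian_idealMl _ f k.
(* The multiplier xyz isolates the constant term; then yz, xz, xy isolate the linear coefficients,
   and x, y, z the quadratic ones. *)
have a0 : a = 0.
  have N0 : vanish0 (b0%:MP * x + b1%:MP * y + b2%:MP * z + g0%:MP * (y * z)
      + g1%:MP * (x * z) + g2%:MP * (x * y) + c%:MP * (x * y * z)).
    by rewrite /vanish0 !(mevalD, mevalM, mevalXU); ring.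
  apply: (cf _ _ (N (x * y * z) _)); first by rewrite -mulrA; apply: v.
  by apply: (jacobian_ideal_eq (M0 _ N0)); ring.
subst a.
have b00 : b0 = 0.
  apply: (cf _ _ (N (y * z) (v 1 z))); rewrite mpolyC0.
  apply: (jacobian_ideal_eq (D _ _ (M (b1%:MP + g0%:MP * z + g2%:MP * x + c%:MP * (x * z)) _ (S 1 2 erefl))
    (M (b2%:MP + g1%:MP * x) _ (S 2 1 erefl)))); ring.
have b10 : b1 = 0.
  apply: (cf _ _ (N (x * z) (v 0 z))); rewrite mpolyC0.
  apply: (jacobian_ideal_eq (D _ _ (M (b0%:MP + g1%:MP * z + g2%:MP * y + c%:MP * (y * z)) _ (S 0 2 erefl))
    (M (b2%:MP + g0%:MP * y) _ (S 2 0 erefl)))); ring.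
have b20 : b2 = 0.
  apply: (cf _ _ (N (x * y) (v 0 y))); rewrite mpolyC0.
  apply: (jacobian_ideal_eq (D _ _ (M (b0%:MP + g1%:MP * z + g2%:MP * y + c%:MP * (y * z)) _ (S 0 1 erefl))
    (M (b1%:MP + g0%:MP * z) _ (S 1 0 erefl)))); ring.
subst b0 b1 b2.
have v1 i : vanish0 ('X_i : {mpoly K[3]}) by rewrite /vanish0 mevalXU.
have g00 : g0 = 0.
  apply: (cf _ _ (N _ (v1 0))); rewrite mpolyC0.
  apply: (jacobian_ideal_eq (D _ _ (M g1%:MP _ (S 0 2 erefl)) (D _ _ (M g2%:MP _ (S 0 1 erefl))
    (M c%:MP _ (Mxyz 0))))); ring.
have g10 : g1 = 0.
  apply: (cf _ _ (N _ (v1 1))); rewrite mpolyC0.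
  apply: (jacobian_ideal_eq (D _ _ (M g0%:MP _ (S 1 2 erefl)) (D _ _ (M g2%:MP _ (S 1 0 erefl))
    (M c%:MP _ (Mxyz 1))))); ring.
have g20 : g2 = 0.
  apply: (cf _ _ (N _ (v1 2))); rewrite mpolyC0.
  apply: (jacobian_ideal_eq (D _ _ (M g0%:MP _ (S 2 1 erefl)) (D _ _ (M g1%:MP _ (S 2 0 erefl))
    (M c%:MP _ (Mxyz 2))))); ring.
subst g0 g1 g2; rewrite mpolyC0 in JN.
have Jc : J (p - c%:MP * (x * y * z)) by apply: (jacobian_ideal_eq JN); ring.
rewrite (hesse_pairing_mod Jc) -mul_mpolyC.
apply: (jacobian_ideal_eq (jacobian_idealB Jc (M (h^-1 * c)%:MP _ HJ))).
have -> : c%:MP = (h^-1 * c)%:MP * h%:MP :> {mpoly K[3]}.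
  by rewrite -mpolyCM mulrAC mulVf // mul1r.
move: (h%:MP) ((h^-1 * c)%:MP) => u w; ring.
Qed.

(** In the cube of a linear form the mixed squares vanish modulo the ideal, each cube becomes - 2 d
    xyz, and xyz itself has multinomial coefficient 6. *)
Lemma associated_form_hesse (v : 'rV[K]_3) :
  associated_form f v = h^-1 * (6 * (v 0 0 * v 0 1 * v 0 2)
    - 2 * d * (v 0 0 ^+ 3 + v 0 1 ^+ 3 + v 0 2 ^+ 3)).
Proof.
rewrite (associated_formE socle_functional_hesse); congr (_ * _).
apply: hesse_pairing_mod; rewrite sum_ord3 -!mul_mpolyC.
have S i j := @jacobian_hesse_sqM _ _ _ fE d_ndeg i j.
have Cu := jacobian_hesse_cube fE.
move: (v 0 0) (v 0 1) (v 0 2) => a b c.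
have D := @jacobian_idealD _ f; have M k := @jacobian_idealMl _ f k.
apply: (jacobian_ideal_eq (D _ _ (M (a%:MP ^+ 3) _ (Cu 0)) (D _ _ (M (b%:MP ^+ 3) _ (Cu 1))
  (D _ _ (M (c%:MP ^+ 3) _ (Cu 2)) (D _ _ (M (3 * a%:MP ^+ 2 * b%:MP) _ (S 0 1 erefl))
  (D _ _ (M (3 * a%:MP ^+ 2 * c%:MP) _ (S 0 2 erefl)) (D _ _ (M (3 * b%:MP ^+ 2 * a%:MP) _ (S 1 0 erefl))
  (D _ _ (M (3 * b%:MP ^+ 2 * c%:MP) _ (S 1 2 erefl)) (D _ _ (M (3 * c%:MP ^+ 2 * a%:MP) _ (S 2 0 erefl))
   (M (3 * c%:MP ^+ 2 * b%:MP) _ (S 2 1 erefl))))))))))).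
rewrite mpolyCB (mpolyCM _ 6) (mpolyC_nat 3 K 6) (mpolyCM _ (2 * d)).
have -> : (a * b * c)%:MP = a%:MP * b%:MP * c%:MP :> {mpoly K[3]} by rewrite !mpolyCM.
have -> : (a ^+ 3 + b ^+ 3 + c ^+ 3)%:MP = a%:MP ^+ 3 + b%:MP ^+ 3 + c%:MP ^+ 3 :> {mpoly K[3]}.
  by rewrite !mpolyCD !rmorphXn.
ring.
Qed.

End HesseAssociatedForm.

(** * Tangent directions at the Fermat cubic *)

Section TangentSpace.
Variable K : numFieldType.
Local Notation x := ('X_0 : {mpoly K[3]}).
Local Notation y := ('X_1 : {mpoly K[3]}).
Local Notation z := ('X_2 : {mpoly K[3]}).

Definition row_form (C : 'M[K]_3) i : {mpoly K[3]} := \sum_j C i j *: 'X_j.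

Lemma row_form_homog C i : row_form C i \is 1.-homog.
Proof.
by apply: rpred_sum => j _; apply: rpredZ; rewrite dhomogX /= mdeg1.
Qed.

(* The monomials X_i^2 X_j and X_0 X_1 X_2 span the cubics: this is the tangent
   space at the Fermat cubic to the GL_3-orbit of the Hesse pencil. *)
Lemma cubic_tangent (s : cubic K) : exists (C : 'M[K]_3) (d : K),
  (s : {mpoly K[3]}) = 3 * (x ^+ 2 * row_form C 0 + y ^+ 2 * row_form C 1
     + z ^+ 2 * row_form C 2) + (6 * d) *: (x * y * z).
Proof.
pose T (C : 'M[K]_3) (d : K) := 3 * (x ^+ 2 * row_form C 0 + y ^+ 2 * row_form C 1
     + z ^+ 2 * row_form C 2) + (6 * d) *: (x * y * z).
pose S p := exists C d, p = T C d.
have rfD a C C' i : row_form (a *: C + C') i = a *: row_form C i + row_form C' i.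
  rewrite /row_form scaler_sumr -big_split; apply: eq_bigr => j _.
  by rewrite !mxE scalerDl scalerA.
have SD a p q : S p -> S q -> S (a *: p + q).
  move=> [C [d ->]] [C' [d' ->]]; exists (a *: C + C'), (a * d + d').
  rewrite /T !rfD -!mul_mpolyC !(mpolyCM, mpolyCD); ring.
have S0 : S 0.
  exists 0, 0; have r0 i : row_form 0 i = 0.
    by rewrite /row_form big1 // => j _; rewrite mxE scale0r.
  by rewrite /T !r0 !mulr0 scale0r !addr0 mulr0.
have Ssq i j : S ('X_i ^+ 2 * 'X_j).
  (* With this matrix row i is X_j / 3 and the other rows are zero, which cancels the factor 3 in
     [T]. *)
  exists (3^-1 *: delta_mx i j), 0.
  have rE k : row_form (3^-1 *: delta_mx i j) k = (3^-1 *+ (k == i))%:MP * 'X_j.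
    rewrite /row_form (bigD1 j) //= big1 ?addr0 => [|l lj].
      by rewrite !mxE eqxx andbT mul_mpolyC mulr_natr.
    by rewrite !mxE (negPf lj) andbF mulr0 scale0r.
  have h : 3 * (3^-1 : K)%:MP = 1 :> {mpoly K[3]}.
    by rewrite -[3](mpolyC_nat 3 K) -mpolyCM divff ?mpolyC1 // pnatr_eq0.
  rewrite /T !rE (mulr0 6) scale0r addr0.
  have hM p q : p * q = 3 * (p * (3^-1%:MP * q)) :> {mpoly K[3]}.
    by rewrite mulrCA 2!mulrA -[p * 3 * _]mulrA h mulr1.
  elim/ord3_ind: i {rE} => /=; rewrite !mulr1n !mulr0n mpolyC0 !mul0r !mulr0 ?addr0 ?add0r;
    exact: hM.
have Sxyz : S (x * y * z).
  exists 0, 6^-1; have r0 i : row_form 0 i = 0.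
    by rewrite /row_form big1 // => j _; rewrite mxE scale0r.
  by rewrite /T !r0 !mulr0 !addr0 mulr0 add0r mulfV ?pnatr_eq0 // scale1r.
suff [C [d sE]] : S s by exists C, d.
rewrite [s : {mpoly K[3]}]mpolyE big_seq.
elim/big_ind: _ => [//|p q Sp Sq|m ms].
  by rewrite -[p]scale1r; apply: SD.
rewrite -[_ *: _]addr0; apply: (SD _ _ _ _ S0).
have : mdeg m = 3%N by move/dhomogP: (dhomog_is_dhomog s); apply.
rewrite mdegE sum_ord3 mpolyXE_id.
have -> : \prod_(i < 3) 'X_i ^+ m i = x ^+ m 0 * y ^+ m 1 * z ^+ m 2 :> {mpoly K[3]}.
  rewrite !big_ord_recl big_ord0 mulr1 mulrA.
  have e1 : lift ord0 ord0 = 1 :> 'I_3 by apply: val_inj.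
  have e2 : lift ord0 (lift ord0 ord0) = 2 :> 'I_3 by apply: val_inj.
  by rewrite e2 e1.
have eqS p q : S p -> p = q -> S q by move=> Sp <-.
(* Total degree 3 leaves ten exponent triples: xyz and the nine products of a square and a
   variable. *)
move: (m 0) (m 1) (m 2) => [|[|[|[|a]]]] [|[|[|[|b]]]] [|[|[|[|c]]]] //= _;
  first [by apply: (eqS _ _ Sxyz); ring
        |by apply: (eqS _ _ (Ssq 0 0)); ring | by apply: (eqS _ _ (Ssq 0 1)); ring
        |by apply: (eqS _ _ (Ssq 0 2)); ring | by apply: (eqS _ _ (Ssq 1 0)); ring
        |by apply: (eqS _ _ (Ssq 1 1)); ring | by apply: (eqS _ _ (Ssq 1 2)); ring
        |by apply: (eqS _ _ (Ssq 2 0)); ring | by apply: (eqS _ _ (Ssq 2 1)); ring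
        |by apply: (eqS _ _ (Ssq 2 2)); ring].
Qed.

End TangentSpace.

(** * Weights of invariants and contravariants under GL_3 *)

Section SemiInvariance.
Variable K : numClosedFieldType.
Implicit Types (B : 'M[K]_3) (f : cubic K) (z : 'rV[K]_3).

Lemma subst_mxZ (c : K) B f : subst_mx (c *: B) f = c ^+ 3 *: subst_mx B f.
Proof.
rewrite !comp_mpolyE scaler_sumr big_seq [RHS]big_seq; apply: eq_bigr => m mf.
have -> : c ^+ 3 = c ^+ mdeg m.
  by congr (_ ^+ _); symmetry; move/dhomogP: (dhomog_is_dhomog f); apply.
rewrite scalerA mulrC -scalerA; congr (_ *: _).
rewrite mdegE -prodrXr -scaler_prod; apply: eq_bigr => i _.
rewrite !tnth_mktuple -exprZn scaler_sumr; congr (_ ^+ _).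
by apply: eq_bigr => k _; rewrite mxE scalerA.
Qed.

(* K contains a cube root of det B, so B is a scalar times an element of SL_3. *)
Lemma act_SL3 B : B \in unitmx -> exists (c : K) (B1 : 'M[K]_3),
  [/\ c ^+ 3 = (\det B)^-1, B1 \in unitmx, \det B1 = 1,
      forall f, act B f = c ^+ 3 *: act B1 f
    & forall z, dual_act B z = c *: dual_act B1 z].
Proof.
move=> Bu; have B0 : \det B != 0 by rewrite -unitfE -unitmxE.
pose c := 3.-root (\det B)^-1; have c3 : c ^+ 3 = (\det B)^-1 by rewrite rootCK.
have c0 : c != 0 by have := invr_neq0 B0; rewrite -c3 expf_eq0.
have BE : invmx B = c *: invmx (c *: B).
  by rewrite invmxZ // ?scalerA ?divff ?scale1r // unitmxZ ?unitfE.
exists c, (c *: B); split=> //.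
- by rewrite unitmxZ ?unitfE.
- by rewrite detZ c3 mulVf.
- move=> f; apply: val_inj => /=.
  rewrite [LHS](_ : _ = subst_mx (invmx B) f) // [in LHS]BE.
  exact: subst_mxZ.
- by move=> z; rewrite /dual_act BE -scalemxAr.
Qed.

Lemma invariant_act n (I : cubic K -> K) B f :
  homogeneous_fun n I -> SL3_invariant I -> B \in unitmx ->
  I (act B f) = (\det B)^-1 ^+ n * I f.
Proof.
move=> In Iinv /act_SL3[c [B1 [c3 _ B1d Bf _]]].
by rewrite Bf In c3 Iinv.
Qed.

(** Degree n contributes (c^3)^n and class 3 one more c^3, hence the exponent n + 1; on SL_3 the
    power of the determinant is 1 whatever k is. *)
Lemma contravariant_act n (L : cubic K -> 'rV[K]_3 -> K) B f z :
  contravariant_of n 3 L -> B \in unitmx ->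
  L (act B f) (dual_act B z) = (\det B)^-1 ^+ n.+1 * L f z.
Proof.
case=> [[_ [k Lk]] Ln L3] /act_SL3[c [B1 [c3 B1u B1d Bf Bz]]].
by rewrite Bf Bz Ln L3 c3 (Lk B1 f z) // B1d exp1rz mul1r exprSr mulrA.
Qed.

End SemiInvariance.

(** * The identity on orbits of Hesse cubics, and its extension *)

Section HesseIdentity.
Variable K : numClosedFieldType.
Variables (I4 I6 : cubic K -> K) (P Q : cubic K -> 'rV[K]_3 -> K).
Variable DPhi : cubic K -> cubic K.
Hypotheses (hI4 : aronhold_I4 I4) (hI6 : aronhold_I6 I6).
Hypotheses (hP : pippian P) (hQ : quippian Q) (hDPhi : is_DeltaPhi I4 I6 DPhi).

(** Exponents of det B: - 12 from the discriminant and + 2 from the associated form on the left, - 6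
    - 4 and - 4 - 6 from the two products on the right. What remains is an identity in d and w. *)
Lemma DeltaPhi_act_hesse (B : 'M[K]_3) (f : cubic K) (d : K) (z : 'rV[K]_3) :
  B \in unitmx -> 1 + 8 * d ^+ 3 != 0 -> hesse_form f 1 1 1 d ->
  (DPhi (act B f) : {mpoly K[3]}).@[fun j => z 0 j] =
    - (1 / 36) * I6 (act B f) * P (act B f) z - (1 / 27) * I4 (act B f) * Q (act B f) z.
Proof.
move=> Bu d0 fE.
have [_ I4h I4i I4E] := hI4; have [_ I6h I6i I6E] := hI6.
have [Pc PE] := hP; have [Qc QE] := hQ; have [_ DE] := hDPhi.
have B0 : \det B != 0 by rewrite -unitfE -unitmxE.
have -> : z = dual_act B (z *m B) by rewrite /dual_act mulmxK.
move: (z *m B) => w.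
have DeltaE : discriminant I4 I6 (act B f) = (\det B)^-1 ^+ 12 * (1 + 8 * d ^+ 3) ^+ 3.
  rewrite /discriminant (invariant_act f I4h I4i Bu) (invariant_act f I6h I6i Bu).
  by rewrite (I4E _ _ _ _ _ fE) (I6E _ _ _ _ _ fE); ring.
rewrite DE; last by rewrite DeltaE mulf_neq0 // expf_neq0 // invr_neq0.
rewrite DeltaE (associated_form_act w Bu (socle_functional_hesse fE d0)).
rewrite (associated_form_hesse fE d0).
rewrite (invariant_act f I4h I4i Bu) (invariant_act f I6h I6i Bu).
rewrite (contravariant_act f w Pc Bu) (contravariant_act f w Qc Bu).
rewrite (I4E _ _ _ _ _ fE) (I6E _ _ _ _ _ fE) (PE _ _ _ _ _ fE) (QE _ _ _ _ _ fE).
move: (w 0 0) (w 0 1) (w 0 2) (\det B) B0 => a b c e e0.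
by field; rewrite e0 d0.
Qed.

Lemma DeltaPhi_polynomial (z : 'rV[K]_3) :
  polynomial_fun (fun f => (DPhi f : {mpoly K[3]}).@[fun j => z 0 j] +
    ((1 / 36) * (I6 f * P f z) + (1 / 27) * (I4 f * Q f z))).
Proof.
have [I4p _ _ _] := hI4; have [I6p _ _ _] := hI6.
have [[[Pp _] _ _] _] := hP; have [[[Qp _] _ _] _] := hQ; have [Dp _] := hDPhi.
have fixz (L : cubic K -> 'rV[K]_3 -> K) :
    polynomial_fun (fun v : (cubic K * 'rV[K]_3)%type => L v.1 v.2) ->
    polynomial_fun (fun f => L f z).
  move=> Lp; have lin : linear (fun f : cubic K => (f, 0 : 'rV[K]_3)).
    by move=> a f g; congr pair; rewrite /= scaler0 addr0.
  have := polynomial_fun_affine (0, z) lin Lp.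
  by under eq_fun => f do rewrite /= addr0 add0r.
apply: polynomial_funD.
  apply: (@polynomial_map_scalar _ _ _ _
    (fun g : cubic K => (g : {mpoly K[3]}).@[fun j => z 0 j])) => //.
  by move=> a g h; rewrite -mevalZ -mevalD -linearP.
by apply: polynomial_funD; (apply: polynomial_funM; first exact: polynomial_fun_cst);
   apply: polynomial_funM => //; apply: fixz.
Qed.

Lemma DeltaPhi_identity (f : cubic K) (z : 'rV[K]_3) :
  (DPhi f : {mpoly K[3]}).@[fun j => z 0 j] =
    - (1 / 36) * I6 f * P f z - (1 / 27) * I4 f * Q f z.
Proof.
suff : (DPhi f : {mpoly K[3]}).@[fun j => z 0 j] +
    ((1 / 36) * (I6 f * P f z) + (1 / 27) * (I4 f * Q f z)) = 0.
  by move/eqP; rewrite addr_eq0 => /eqP ->; ring.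
have h_homog d : 'X_0 ^+ 3 + 'X_1 ^+ 3 + 'X_2 ^+ 3 + (6 * d) *: ('X_0 * 'X_1 * 'X_2)
    \is [in K[3], 3.-homog].
  have X1 i : 'X_i \is [in K[3], 1.-homog] by rewrite dhomogX /= mdeg1.
  have X3 i : 'X_i ^+ 3 \is [in K[3], 3.-homog] by apply: (dhomogMn 3 (X1 i)).
  by do !apply: rpredD => //; apply: rpredZ; apply: (dhomogM (dhomogM (X1 _) (X1 _)) (X1 _)).
pose h d : cubic K := DHomog (h_homog d).
move: f; apply: (polynomial_fun_eq0_curves (v0 := h 0) (DeltaPhi_polynomial z)) => s.
have [C [d sE]] := cubic_tangent s.
pose l := row_form C; have l1 i : l i \is 1.-homog by apply: row_form_homog.
have X1 i : 'X_i \is [in K[3], 1.-homog] by rewrite dhomogX /= mdeg1.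
have H3 p q r : p \is 1.-homog -> q \is 1.-homog -> r \is 1.-homog ->
  p * q * r \is [in K[3], 3.-homog] by move=> hp hq hr; apply: (dhomogM (dhomogM hp hq) hr).
(* The three forms are the coefficients of t^2, t^3 and t^4 in the substitution of 1 + t C into h_(t
   d); its t-coefficient is s by the choice of C and d. *)
have w0h : 3 *: ('X_0 * l 0 * l 0 + 'X_1 * l 1 * l 1 + 'X_2 * l 2 * l 2)
   + (6 * d) *: ('X_1 * 'X_2 * l 0 + 'X_0 * 'X_2 * l 1 + 'X_0 * 'X_1 * l 2) \is 3.-homog.
  by do !(apply: rpredD || apply: rpredZ); apply: H3.
have w1h : l 0 * l 0 * l 0 + l 1 * l 1 * l 1 + l 2 * l 2 * l 2
   + (6 * d) *: ('X_0 * l 1 * l 2 + 'X_1 * l 0 * l 2 + 'X_2 * l 0 * l 1) \is 3.-homog.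
  by do !(apply: rpredD || apply: rpredZ); apply: H3.
have w2h : (6 * d) *: (l 0 * l 1 * l 2) \is 3.-homog by apply: rpredZ; apply: H3.
exists 3%N, (fun k => tnth [tuple DHomog w0h; DHomog w1h; DHomog w2h] k).
(* [D1] vanishes where 1 + t C is singular, [D2] where h_(t d) is degenerate; both take the value 1
   at t = 0, so neither is the zero polynomial. *)
pose D1 : {poly K} := \det (1%:M + 'X *: map_mx polyC C).
pose D2 : {poly K} := 1 + (8 * d ^+ 3) *: 'X^3.
have D1E t : D1.[t] = \det (1%:M + t *: C).
  rewrite -[LHS]/(horner_eval t D1) -det_map_mx; congr (\det _); apply/matrixP => i j.
  by rewrite !mxE /= /horner_eval !hornerE; case: (i == j); rewrite ?hornerC ?horner0.
have D2E t : D2.[t] = 1 + 8 * (t * d) ^+ 3.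
  by rewrite /D2 hornerD hornerZ hornerXn hornerC; ring.
exists (D1 * D2); split.
  rewrite mulf_neq0 //; apply/eqP => /(congr1 (fun p => p.[0]))/eqP; rewrite horner0.
    by rewrite D1E scale0r addr0 det1 oner_eq0.
  by rewrite D2E mul0r expr0n mulr0 addr0 oner_eq0.
move=> t; rewrite hornerM mulf_eq0 negb_or D1E D2E => /andP[A0 td0].
set A := 1%:M + t *: C in A0.
have Au : A \in unitmx by rewrite unitmxE unitfE.
(* Since [act] substitutes the inverse matrix, the curve lies on orbits through [invmx A]. *)
have -> : h 0 + t *: s + \sum_(k < 3) t ^+ k.+2 *:
    tnth [tuple DHomog w0h; DHomog w1h; DHomog w2h] k = act (invmx A) (h (t * d)).
  apply: val_inj; rewrite [RHS](_ : _ = subst_mx A (h (t * d))); last first.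
    by rewrite /= /act_poly invmxK.
  have AX i : subst_mx A 'X_i = 'X_i + t%:MP * l i.
    rewrite subst_mxX mul_mpolyC /l /row_form scaler_sumr.
    rewrite -[X in X + _]subst_mx1 subst_mxX -big_split; apply: eq_bigr => j _.
    by rewrite !mxE scalerDl scalerA.
  rewrite sum_ord3 -[X in t ^+ X *: tnth _ 1]/3%N -[X in t ^+ X *: tnth _ 2]/4%N /=.
  rewrite sE -!/(l _) !(comp_mpolyD, comp_mpolyZ) !comp_mpolyM !AX.
  rewrite mulr0 scale0r -!mul_mpolyC.
  rewrite !(mpolyCM _ 6) (mpolyCM _ t d) (mpolyC_nat 3 K 6) (mpolyC_nat 3 K 3).
  have tX n : (t ^+ n)%:MP = t%:MP ^+ n :> {mpoly K[3]} by rewrite rmorphXn.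
  rewrite !tX; move: (l 0) (l 1) (l 2) (t%:MP) (d%:MP) => a b c t' d'.
  ring.
apply/eqP; rewrite addr_eq0; apply/eqP.
rewrite (DeltaPhi_act_hesse z _ td0) ?unitmx_inv //; first by ring.
by rewrite /hesse_form /= !scale1r.
Qed.

End HesseIdentity.

Theorem mainTheorem4 (R : realType)
    (I4 I6 : cubic R[i] -> R[i]) (P Q : cubic R[i] -> 'rV[R[i]]_3 -> R[i])
    (DPhi : cubic R[i] -> cubic R[i])
    (hI4 : aronhold_I4 I4) (hI6 : aronhold_I6 I6)
    (hP : pippian P) (hQ : quippian Q)
    (hDPhi : is_DeltaPhi I4 I6 DPhi)
    (f : cubic R[i]) (z : 'rV[R[i]]_3) :
  (DPhi f : {mpoly R[i][3]}).@[fun j => z 0 j] =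
    - (1 / 36) * I6 f * P f z - (1 / 27) * I4 f * Q f z.
Proof. exact: (DeltaPhi_identity hI4 hI6 hP hQ hDPhi). Qed.
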